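(* For all integers $n\ge k\ge 0$, the entries $f_{n,k}(q)$ of the $q$-forests matrix satisfy $$f_{n,k}(q)=\sum_{F\in\mathcal{F}_{n,k}}q^{\operatorname{niblings}(F)+\operatorname{scindex}(F)+\operatorname{parents}(F)-|V_t(F)|},$$ where $\mathcal{F}_{n,k}$ denotes the set of forests of rooted labelled trees on the vertex set $[n]=\{1,\dots,n\}$ with $k$ components. (Here $|V_t(F)|=n-k-1$ if $n>k$, and $|V_t(F)|=0$ if $n=k$.)
   Context: $[n]_q=1+q+\cdots+q^{n-1}$ for $n>0$, $[0]_q=0$, and $\binom{n}{k}_q$ is the $q$-binomial coefficient. The $q$-forests numbers are $f_{n,k}(q)=\delta_{nk}$ if $k=0$, $f_{n,k}(q)=\binom{n-1}{k-1}_q([n]_q)^{n-k}$ if $n\ge k\ge1$, and $0$ otherwise. Let $F$ be a forest of rooted labelled trees on $[n]$ with $k$ components. Let $V_r(F)$ be the set of roots of components of $F$. If $F$ has a non-root vertex (i.e. $n>k$), let $v_{\min}$ be the lowest-numbered vertex among all children of roots, and let $V_s(F)=\{v_{\min}\}$; if $n=k$, let $V_s(F)=\emptyset$. Let $V_t(F)$ be the set of all remaining vertices. Define: - for each $v\in V_r(F)$, $V_r(F,v)=\{v' : v'\notin V_r(F),\ v'<v\}$, and $\operatorname{niblings}(F)=\sum_{v\in V_r(F)}|V_r(F,v)|$; - writing the roots as $v_0<v_1<\cdots<v_{k-1}$, $\operatorname{scindex}(F)=j$ where $v_j$ is the parent of $v_{\min}$ (and $\operatorname{scindex}(F)=0$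 if $n=k$); - $\operatorname{parents}(F)=\sum_{v\in V_t(F)}\operatorname{parent}(v)$, where $\operatorname{parent}(v)$ is the label of the parent of $v$. *)

(* Defs.v *)
From mathcomp Require Import all_boot all_order all_algebra.
From mathcomp Require Import ring.

Set Implicit Arguments.
Unset Strict Implicit.
Unset Printing Implicit Defensive.

Import GRing.Theory.
Local Open Scope ring_scope.

(* The indeterminate q is 'X, and all q-analogues live in Z[q]. *)

Definition qnum (n : nat) : {poly int} := \sum_(i < n) 'X^i.

Definition qfact (n : nat) : {poly int} := \prod_(i < n) qnum i.+1.

(* The divisor is monic, so [%/] is genuine Euclidean division in Z[q];
   it is exact, see [qbinomE]. *)
Definition qbinom (n k : nat) : {poly int} :=
  if (k <= n)%N then qfact n %/ (qfact k * qfact (n - k)) else 0.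

Definition qforests (n k : nat) : {poly int} :=
  if k == 0%N then (n == k)%:R
  else if (k <= n)%N then qbinom n.-1 k.-1 * qnum n ^+ (n - k)
  else 0.

(* A forest of rooted trees is given by its parent map: [F v = Some u] when [u]
   is the parent of [v], and [F v = None] when [v] is a root.  The vertex
   [i : 'I_n] carries the label [i.+1], so that the labels run over 1, ..., n. *)

Definition parent_map (n : nat) := {ffun 'I_n -> option 'I_n}.

Section Forests.
Variable n : nat.
Implicit Types (F : parent_map n) (u v r : 'I_n).

Definition label v : nat := v.+1.

Definition up F : rel 'I_n := [rel v u | F v == Some u].

Definition adj F : rel 'I_n := [rel u v | up F u v || up F v u].

(* Each vertex has at most one parent, so the underlying graph is a forest iff
   no vertex is an ancestor of its own parent (loops and 2-cycles included). *)
Definition acyclic F : bool :=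
  [forall v, forall u, up F v u ==> ~~ connect (up F) u v].

Definition forests (k : nat) : {set parent_map n} :=
  [set F | acyclic F & n_comp (adj F) 'I_n == k].

Definition Vr F : {set 'I_n} := [set v | F v == None].

Definition root_children F : {set 'I_n} :=
  [set v | [exists r in Vr F, F v == Some r]].

Definition vmin F : option 'I_n :=
  [pick v in root_children F
    | [forall w in root_children F, (label v <= label w)%N]].

Definition Vs F : {set 'I_n} := if vmin F is Some v then [set v] else set0.

Definition Vt F : {set 'I_n} := ~: (Vr F :|: Vs F).

Definition niblings F : nat :=
  (\sum_(v in Vr F) #|[set v' | v' \notin Vr F & label v' < label v]|)%N.

(* [enum (Vr F)] lists the roots v_0 < v_1 < ... in increasing order. *)
Definition scindex F : nat :=
  if vmin F is Some v then
    if F v is Some r then index r (enum (Vr F)) else 0%N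
  else 0%N.

(* The value 0 at a root is never used: [Vt F] contains no root. *)
Definition parent_label F v : nat := if F v is Some u then label u else 0%N.

Definition parents F : nat := (\sum_(v in Vt F) parent_label F v)%N.

(* The truncated subtraction is harmless: labels are positive, so
   [#|Vt F| <= parents F], see [card_Vt_le_parents]. *)
Definition forest_weight F : nat :=
  (niblings F + scindex F + parents F - #|Vt F|)%N.

End Forests.

Lemma qnumS n : qnum n.+1 = qnum n + 'X^n.
Proof. by rewrite /qnum big_ord_recr. Qed.

Lemma qnumD m n : qnum (m + n) = qnum m + 'X^m * qnum n.
Proof.
elim: n => [|n IHn]; first by rewrite addn0 {3}/qnum big_ord0 mulr0 addr0.
by rewrite addnS !qnumS IHn mulrDr -exprD addrA.
Qed.

Lemma qfactS n : qfact n.+1 = qfact n * qnum n.+1.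
Proof. by rewrite /qfact big_ord_recr. Qed.

Lemma qfact0 : qfact 0 = 1.
Proof. by rewrite /qfact big_ord0. Qed.

Lemma qfact_monic n : qfact n \is monic.
Proof.
apply: monic_prod => i _; rewrite qnumS monicE addrC lead_coefDl ?lead_coefXn //.
rewrite size_polyXn ltnS; apply: leq_trans (size_sum _ _ _) _.
by apply/bigmax_leqP => j _; rewrite size_polyXn.
Qed.

Lemma qfact_dvd m n : exists b, qfact (m + n) = b * (qfact m * qfact n).
Proof.
move: {2}(m + n)%N (leqnn (m + n)) => N; elim: N m n => [|N IHN] m n.
  rewrite leqn0 addn_eq0 => /andP[/eqP-> /eqP->].
  by exists 1; rewrite addn0 !qfact0 !mul1r.
case: m => [|m]; first by exists 1; rewrite add0n qfact0 !mul1r.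
case: n => [|n]; first by exists 1; rewrite addn0 qfact0 mulr1 mul1r.
rewrite addSn ltnS => le_mnN.
have [b1 e1] := IHN m n.+1 le_mnN.
have [b2 e2] : exists b, qfact (m.+1 + n) = b * (qfact m.+1 * qfact n).
  by apply: IHN; rewrite addSnnS.
exists (b1 + 'X^(m.+1) * b2).
have eq_num : qnum (m + n.+1).+1 = qnum m.+1 + 'X^(m.+1) * qnum n.+1.
  by rewrite -qnumD.
rewrite addSnnS in e2.
rewrite (qfactS (m + n.+1)) eq_num mulrDr {1}e1 e2.
by rewrite (qfactS m) (qfactS n); ring.
Qed.

Lemma qbinomE n k : (k <= n)%N ->
  qbinom n k * (qfact k * qfact (n - k)) = qfact n.
Proof.
move=> le_kn; rewrite /qbinom le_kn; have := qfact_dvd k (n - k).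
rewrite subnKC // => -[b ->].
by rewrite Pdiv.IdomainMonic.mulpK // rpredM ?qfact_monic.
Qed.

Section ForestFacts.
Variable n : nat.
Implicit Types (F : parent_map n) (u v r : 'I_n).

Lemma upE F v u : up F v u = (F v == Some u).
Proof. by []. Qed.

Lemma adjE F u v : adj F u v = up F u v || up F v u.
Proof. by []. Qed.

Lemma adj_connect_sym F : connect_sym (adj F).
Proof. by apply: sym_connect_sym => u v; rewrite !adjE orbC. Qed.

Lemma acyclic_connect_root F v :
  acyclic F -> exists2 r, r \in Vr F & connect (up F) v r.
Proof.
move=> /forallP acF.
have [m] := ubnP #|[set w | connect (up F) v w]|; elim: m v => // m IHm v lt_m.
case Fv: (F v) => [u|]; last by exists v; rewrite ?inE ?Fv.
have upvu : up F v u by rewrite upE Fv.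
have Cvu : connect (up F) v u by apply: connect1.
have [|r rF Cur] := IHm u; last by exists r => //; apply: connect_trans Cur.
apply: leq_trans (_ : #|[set w | connect (up F) v w]| <= m)%N; last by [].
apply: proper_card; apply/properP; split.
  by apply/subsetP=> w; rewrite !inE; apply: connect_trans.
exists v; rewrite inE ?connect0 //.
by have /forallP/(_ u)/implyP/(_ upvu) := acF v.
Qed.

Lemma connect_up_step F v u r :
  up F v u -> r \in Vr F -> connect (up F) v r -> connect (up F) u r.
Proof.
rewrite upE inE => /eqP Fv /eqP Fr /connectP[[|w p] /=].
  by move=> _ rv; rewrite -rv Fr in Fv.
by rewrite upE Fv => /andP[/eqP[<-] pP] ->; apply/connectP; exists p.
Qed.

Lemma connect_up_root_uniq F v r r' : r \in Vr F -> r' \in Vr F ->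
  connect (up F) v r -> connect (up F) v r' -> r = r'.
Proof.
move=> rF r'F /connectP[p]; elim: p v => [|u p IHp] v /=.
  move=> _ rv /connectP[[|w p] /=]; first by rewrite rv.
  by move: rF; rewrite -rv inE upE => /eqP->.
move=> /andP[upvu pP] def_r Cvr'; apply: (IHp u) => //.
exact: connect_up_step Cvr'.
Qed.

Lemma card_Vr F : acyclic F -> #|Vr F| = n_comp (adj F) 'I_n.
Proof.
move=> acF.
pose rt v := odflt v [pick r in Vr F | connect (up F) v r].
have rtP v : rt v \in Vr F /\ connect (up F) v (rt v).
  rewrite /rt; case: pickP => [r /andP[]|no_r] //=.
  have [r rF Cvr] := acyclic_connect_root v acF.
  by have := no_r r; rewrite rF Cvr.
have sub_up v w : connect (up F) v w -> connect (adj F) v w.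
  by apply: connect_sub => x y xy; apply: connect1; rewrite adjE xy.
have rt_up v u : up F v u -> rt v = rt u.
  move=> vu; have [rvF Cv] := rtP v; have [ruF Cu] := rtP u.
  by apply: (connect_up_root_uniq rvF ruF _ Cu); apply: connect_up_step Cv.
have rt_adj v w : connect (adj F) v w -> rt v = rt w.
  case/connectP=> p; elim: p v => [|u p IHp] v /= => [_ -> //|].
  case/andP=> vu pP def_w; rewrite -(IHp u pP def_w).
  by case/orP: vu => /rt_up.
have rt_id r : r \in Vr F -> rt r = r.
  move=> rF; have [rrF Cr] := rtP r.
  exact: (connect_up_root_uniq rrF rF Cr (connect0 _ _)).
have adj_rt v : connect (adj F) v (rt v) by apply: sub_up; case: (rtP v).
have symF := adj_connect_sym F.
pose A := [set v | fingraph.roots (adj F) v].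
have -> : n_comp (adj F) 'I_n = #|A|.
  by apply: eq_card => v; rewrite !inE andbT.
have Aroot v : v \in A -> fingraph.root (adj F) v = v.
  by rewrite inE => /eqP.
rewrite -(card_in_imset (f := rt) (D := A)).
  apply: eq_card => r; apply/idP/imsetP => [rF | [v _ ->]]; last by case: (rtP v).
  exists (fingraph.root (adj F) r); first by rewrite inE roots_root.
  by rewrite -(rt_adj _ _ (connect_root _ r)) rt_id.
move=> v w /Aroot Av /Aroot Aw eq_rt; rewrite -Av -Aw.
apply/eqP; rewrite root_connect //.
by apply: connect_trans (adj_rt v) _; rewrite eq_rt symF.
Qed.

Lemma root_children_neq0 F v :
  acyclic F -> v \notin Vr F -> root_children F != set0.
Proof.
move=> acF vF; have [r rF /connectP[p]] := acyclic_connect_root v acF.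
elim: p v vF => [|u p IHp] v vF /=; first by move=> _ rv; rewrite -rv rF in vF.
case/andP=> vu pP def_r; have [uF|uF] := boolP (u \in Vr F); last exact: IHp def_r.
apply/set0Pn; exists v; rewrite inE; apply/existsP; exists u.
by rewrite uF.
Qed.

Lemma vmin_spec F v : vmin F = Some v ->
  v \in root_children F /\
  {in root_children F, forall w, (label v <= label w)%N}.
Proof.
rewrite /vmin; case: pickP => // u /andP[uF /forall_inP minu] [<-].
by split.
Qed.

Lemma vmin_None F : vmin F = None -> root_children F = set0.
Proof.
rewrite /vmin; case: pickP => // no_v _; apply/eqP/set0Pn => -[v vF].
have := no_v [arg min_(w < v in root_children F) label w].
case: arg_minnP => // w wF minw /=; rewrite wF /= => /negP[].
by apply/forall_inP.
Qed.

Lemma card_Vt F k : F \in forests n k -> #|Vt F| = (n - k - 1)%N.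
Proof.
rewrite inE => /andP[acF /eqP nF]; have cardVr := card_Vr acF; rewrite nF in cardVr.
have -> : #|Vt F| = (n - #|Vr F :|: Vs F|)%N by rewrite /Vt cardsCs setCK card_ord.
rewrite /Vs; case vF: (vmin F) => [v|].
  have [vC _] := vmin_spec vF.
  have vr : v \notin Vr F.
    by move: vC; rewrite !inE => /existsP[r /andP[_ /eqP->]].
  by rewrite setUC cardsU1 vr cardVr add1n subn1 subnS.
rewrite setU0 cardVr; suff -> : k = n by rewrite subnn.
rewrite -cardVr -[RHS]card_ord; apply: eq_card => v; rewrite [RHS]inE.
apply/idPn => vr; have := root_children_neq0 acF vr.
by rewrite (vmin_None vF) eqxx.
Qed.

Lemma card_Vt_le_parents F : (#|Vt F| <= parents F)%N.
Proof.
rewrite /parents -sum1_card; apply: leq_sum => v.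
by rewrite !inE negb_or /parent_label; case: (F v).
Qed.

End ForestFacts.

(* Main.v *)
Require Import Defs.
From mathcomp Require Import all_boot all_order all_algebra.
From mathcomp Require Import ring.
Import GRing.Theory.
Local Open Scope ring_scope.

Set Implicit Arguments.
Unset Strict Implicit.
Unset Printing Implicit Defensive.

(** Sort the forests by their set of roots [R], with [#|R| = k].  The statistic
    niblings depends on [R] only: it counts the pairs made of a root and a
    smaller non-root, so summing [q^niblings] over [R] gives the q-binomial
    coefficient [n] choose [k] ([sum_inversions]), by the usual Pascal
    recursion on the largest element.

    For a fixed [R] the rest of the weight is a product over the non-roots of a
    factor depending on the parent only: [q^u] for a parent of label [u + 1],
    except that the smallest child of a root contributes [q^j] when its parent
    is the [j]-th root.  These products are summed by a weighted Cayley formula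
    ([sum_rooted_Cayley]): if each non-root contributes the weight [x u] of its
    parent [u], the forests with vertex set [V] and root set [R] have total
    weight [x(R) x(V)^(#|V| - #|R| - 1)], where [x(A)] is the sum of [x] over
    [A].  The proof peels off the children of the roots: a forest is a set [S]
    of children, a map from [S] to [R], and a forest on [V :\: R] with root set
    [S] ([sum_layers]).  By induction on the number of non-roots, what is left
    is a sum over the subsets [S], evaluated by the binomial theorem
    ([sum_subsets_member]).

    Given [S], the parent of one child chosen in [S] is a free element of [R].
    So changing the weight of that single parent from [x] to [y] replaces the
    factor [x(R)] by [y(R)] ([sum_rooted_marked]).  With [x u = q^u] and
    [y r = q^j] for the [j]-th root [r], the sum over the forests with root set
    [R] is [[k]_q [n]_q^(n - k - 1)], and the absorption identity
    ([qbinom_absorb]) turns the total into [qforests n k]. *)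

(** * Identities for q-binomial coefficients *)

Lemma qfactM_neq0 j l : qfact j * qfact l != 0.
Proof. by rewrite monic_neq0 // rpredM ?qfact_monic. Qed.

Lemma qbinom_absorb n k : (0 < k <= n)%N ->
  qbinom n k * qnum k = qbinom n.-1 k.-1 * qnum n.
Proof.
case: k n => [|k] [|n] //= le_kn; apply: (mulIf (qfactM_neq0 k (n - k))).
have := qbinomE le_kn; rewrite subSS !qfactS -(qbinomE (n := n) (k := k)) // => eqb.
by rewrite [RHS]mulrAC -eqb; ring.
Qed.

Lemma qbinomnn n : qbinom n n = 1.
Proof.
apply: (mulIf (qfactM_neq0 n 0)).
by have := qbinomE (leqnn n); rewrite subnn qfact0 mulr1 mul1r.
Qed.

(** * Parent maps in which every vertex reaches a root *)

Section RootedMaps.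
Variable n : nat.
Implicit Types (R S U : {set 'I_n}) (F : parent_map n) (u v r : 'I_n).

Definition reach R F v : bool := [exists r in R, connect (up F) v r].

Lemma reach_mem R F v : v \in R -> reach R F v.
Proof. by move=> vR; apply/exists_inP; exists v. Qed.

Lemma reach_parent R F v u : F v = Some u -> reach R F u -> reach R F v.
Proof.
move=> Fv /exists_inP[r rR Cur]; apply/exists_inP; exists r => //.
by apply: connect_trans Cur; apply: connect1; rewrite upE Fv.
Qed.

(** Induction on the distance to [R]. *)
Lemma reach_ind R F (P : 'I_n -> Prop) :
    {in R, forall v, P v} ->
    (forall v u, F v = Some u -> reach R F u -> P u -> P v) ->
  forall v, reach R F v -> P v.
Proof.
move=> PR Pup v /exists_inP[r rR /connectP[p]].
elim: p v => [|u p IHp] v /= => [_ <-|]; first exact: PR.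
case/andP=> /eqP Fv pF def_r; apply: (Pup v u) => //; last exact: IHp.
by apply/exists_inP; exists r => //; apply/connectP; exists p.
Qed.

Lemma reach_None R F v : F v = None -> reach R F v -> v \in R.
Proof.
move=> Fv vR; move: v vR Fv.
by apply: reach_ind => // v u ->.
Qed.

Lemma reach_step R F v u :
  F v = Some u -> v \notin R -> reach R F v -> reach R F u.
Proof.
move=> Fv vR vreach; move: v vreach Fv vR.
apply: reach_ind => [v -> //|v w Fv wreach _].
by rewrite Fv => -[<-].
Qed.

(** A vertex on a cycle never reaches a root: following its ancestors, all of
    them lie on that cycle, whereas a root has no parent. *)
Lemma acyclicE F : acyclic F = [forall v, reach (Vr F) F v].
Proof.
apply/idP/forallP=> [acF v|reachF].
  by have [r rF Cvr] := acyclic_connect_root v acF; apply/exists_inP; exists r.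
apply/forallP=> v; move: v (reachF v).
apply: reach_ind => [v|v u Fv _ Pu].
  by rewrite inE => /eqP Fv; apply/forallP=> u; rewrite upE Fv.
apply/forallP=> w; rewrite upE Fv; apply/implyP=> /eqP[<-] {w}.
have Cvu : connect (up F) v u by apply: connect1; rewrite upE Fv.
have {}Pu w : up F u w -> ~~ connect (up F) w u.
  by move=> uw; have /forallP/(_ w)/implyP/(_ uw) := Pu.
apply/negP=> /connectP[[|w p] /=] => [_ def_v|/andP[uw pF] def_v].
  by have := Pu u; rewrite upE -def_v Fv -def_v eqxx connect0 => /(_ isT).
case/negP: (Pu w uw); apply: connect_trans Cvu.
by apply/connectP; exists p.
Qed.

(** The forests with vertex set [R :|: U] and root set [R], when [R] and [U] are
    disjoint.  A parent outside [R :|: U] has no parent itself, so the second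
    condition excludes it. *)
Definition rooted R U : {set parent_map n} :=
  [set F : parent_map n | [forall v, (F v != None) == (v \in U)]
                        & [forall v in U, reach R F v]].

Definition layer R F : {set 'I_n} := [set v | oapp (mem R) false (F v)].

(** Splitting off the first layer [S] of non-roots: a forest is recovered from
    the parents of [S] and the forest that has [S] as its set of roots. *)
Definition graft S (p : parent_map n * parent_map n) : parent_map n :=
  [ffun v => if v \in S then p.1 v else p.2 v].

Definition cut S F : parent_map n * parent_map n :=
  ([ffun v => if v \in S then F v else None],
   [ffun v => if v \in S then None else F v]).

Lemma cutK S : cancel (cut S) (graft S).
Proof. by move=> F; apply/ffunP=> v; rewrite !ffunE; case: (v \in S). Qed.

Lemma rootedP R U F :
  reflect ((forall v, (F v != None) = (v \in U)) /\
           {in U, forall v, reach R F v})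
          (F \in rooted R U).
Proof.
rewrite inE; apply: (iffP andP) => -[domF reachF]; split.
- by move=> v; exact: (eqP (forallP domF v)).
- exact/forall_inP.
- by apply/forallP=> v; rewrite domF.
- exact/forall_inP.
Qed.

Definition attach R S :=
  pfamily None S (fun _ : 'I_n => [pred o | oapp (mem R) false o]).

Lemma attachP R S (F : parent_map n) :
  reflect ((forall v, (F v != None) = (v \in S)) /\
           {in S, forall v, oapp (mem R) false (F v)})
          (F \in attach R S).
Proof.
apply: (iffP pfamilyP) => [[/subsetP domF FR]|[domF FR]]; split => //.
  move=> v; apply/idP/idP=> [|vS]; first exact: domF.
  by have := FR v vS; rewrite inE; case: (F v).
by apply/subsetP=> v; rewrite inE domF.
Qed.

(** Removing the old roots leaves a forest rooted at their children, because
    every path to a root goes through the first layer. *)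
Lemma cut_rooted R U F : F \in rooted R U -> [disjoint R & U] ->
  [/\ layer R F \subset U, (cut (layer R F) F).1 \in attach R (layer R F)
    & (cut (layer R F) F).2 \in rooted (layer R F) (U :\: layer R F)].
Proof.
case/rootedP=> domF reachF dRU; split.
- by apply/subsetP=> v; rewrite inE -domF; case: (F v).
- apply/attachP; split=> v; rewrite !ffunE; last first.
    by move=> vS; rewrite vS; rewrite inE in vS.
  by rewrite inE; case: (F v) => //= u; case: ifP.
apply/rootedP; split=> v.
  by rewrite !ffunE in_setD -domF; case: (v \in layer R F).
rewrite in_setD => /andP[_ vU]; have vR := reachF v vU; move: v vR vU.
apply: reach_ind => [v vR vU|v u Fv uR IHu vU].
  by have := disjointFr dRU vR; rewrite vU.
have [uinR|uinR] := boolP (u \in R).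
  by apply: reach_mem; rewrite inE Fv.
have uU : u \in U.
  rewrite -domF; apply: contraNneq uinR => Fu; exact: reach_None uR.
have [vS|vS] := boolP (v \in layer R F); first exact: reach_mem.
by apply: reach_parent (IHu uU); rewrite !ffunE (negPf vS).
Qed.

(** No vertex outside [S] gets a parent in [R] by the grafting: such a parent
    would be outside [S] and without a parent in [F'], so the path of [F'] that
    leads from the vertex to [S] could not pass through it.  Hence the first
    layer is exactly [S]. *)
Lemma graft_rooted R U S h F' :
    [disjoint R & U] -> S \subset U ->
    h \in attach R S -> F' \in rooted S (U :\: S) ->
  [/\ graft S (h, F') \in rooted R U, layer R (graft S (h, F')) = S
    & cut S (graft S (h, F')) = (h, F')].
Proof.
move=> dRU sSU /attachP[domh hR] /rootedP[domF' reachF'].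
have F'S v : v \in S -> F' v = None.
  by move=> vS; apply/eqP; rewrite -[_ == _]negbK domF' inE vS.
have hS v : v \notin S -> h v = None.
  by move=> vS; apply/eqP; rewrite -[_ == _]negbK domh.
have reachS v : reach S F' v -> reach R (graft S (h, F')) v.
  move: v; apply: reach_ind => [v vS|v u F'v _]; last first.
    suff Gv : graft S (h, F') v = Some u by apply: reach_parent Gv.
    rewrite ffunE; case: ifP => // vS.
    by rewrite F'S in F'v.
  have := hR v vS; case hv: (h v) => [r|] //= rR.
  by apply: (@reach_parent _ _ v r _ (reach_mem _ rR)); rewrite ffunE vS.
split.
- apply/rootedP; split=> v.
    rewrite ffunE; case: ifP => vS; first by rewrite domh vS (subsetP sSU).
    by rewrite domF' inE vS.
  move=> vU; apply: reachS; have [vS|vS] := boolP (v \in S).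
    exact: reach_mem.
  by apply: reachF'; rewrite inE vS.
- apply/setP=> v; rewrite inE ffunE; case: ifP => vS; first exact: hR.
  case F'v: (F' v) => [u|] //=; apply/negP=> uR.
  have uU : u \notin U by rewrite (disjointFr dRU uR).
  have uS : u \notin S by apply: contra uU; apply: (subsetP sSU).
  have vU : v \in U :\: S by rewrite -domF' F'v.
  have F'u : F' u = None.
    by apply/eqP; rewrite -[_ == _]negbK domF' inE (negPf uU) andbF.
  have := reach_step F'v _ (reachF' v vU); rewrite vS => /(_ isT).
  by move/(reach_None F'u); apply/negP.
- congr (_, _); apply/ffunP=> v; rewrite !ffunE /=.
    by have [//|vS] := boolP (v \in S); rewrite hS.
  by have [vS|//] := boolP (v \in S); rewrite F'S.
Qed.

(** * Peeling off the children of the roots *)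

Section LayerSums.
Variable K : comNzRingType.

Lemma sum_attach R S (w : 'I_n -> 'I_n -> K) :
  \sum_(h in attach R S) \prod_(v in S) oapp (w v) 0 (h v)
    = \prod_(v in S) \sum_(r in R) w v r.
Proof.
transitivity (\prod_(v in S)
    \sum_(o : option 'I_n | oapp (mem R) false o) oapp (w v) 0 o).
  by rewrite (big_distr_big_dep None (mem S) (fun _ o => oapp (mem R) false o)).
apply: eq_bigr => v _; transitivity (\sum_(o in Some @: R) oapp (w v) 0 o).
  2: by rewrite big_imset //= => ? ? _ _ [].
apply: eq_bigl => -[r|] /=; first by rewrite mem_imset // => ? ? [].
by apply/esym/imsetP=> -[].
Qed.

(** The weights may depend on the first layer [S], which is fixed on both sides
    of the bijection between forests and grafted pairs; this is what allows one
    distinguished child of the roots to be weighted differently. *)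
Lemma sum_layers R U (w : {set 'I_n} -> 'I_n -> 'I_n -> K) : [disjoint R & U] ->
  \sum_(F in rooted R U) \prod_(v in U) oapp (w (layer R F) v) 0 (F v)
    = \sum_(S : {set 'I_n} | S \subset U) (\prod_(v in S) \sum_(r in R) w S v r)
        * \sum_(F in rooted S (U :\: S)) \prod_(v in U :\: S) oapp (w S v) 0 (F v).
Proof.
move=> dRU; rewrite (partition_big (layer R) (fun S => S \subset U)); last first.
  by move=> F /cut_rooted/(_ dRU)[].
apply: eq_bigr => S sSU; rewrite -sum_attach big_distrlr pair_big_dep /=.
rewrite (reindex_onto (graft S) (cut S)); last by move=> F _; apply: cutK.
apply: eq_big => [[h F']|[h F'] /andP[/andP[_ /eqP layerS] _]].
  apply/idP/andP=> [/andP[/andP[rF /eqP layerS] /eqP cutS]|[/= hS rF']].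
    by have := cut_rooted rF dRU; rewrite layerS cutS => -[].
  by have [-> -> ->] := graft_rooted dRU sSU hS rF'; rewrite !eqxx.
rewrite layerS (big_setID S) /= (setIidPr sSU); congr (_ * _).
  by apply: eq_bigr => v vS; rewrite ffunE vS.
by apply: eq_bigr => v /setDP[_ vS]; rewrite ffunE (negPf vS).
Qed.

(** Exchanging the sums leaves, for each [u] in [U], the binomial expansion over
    the subsets that contain [u], which is [a (a + b)^(#|U| - 1)].  The extra
    factor [a + b] keeps the exponent natural when [U] is empty. *)
Lemma sum_subsets_member U (x : 'I_n -> K) a b :
  (\sum_(S : {set 'I_n} | S \subset U)
      (\sum_(u in S) x u) * a ^+ #|S| * b ^+ #|U :\: S|) * (a + b)
    = (\sum_(u in U) x u) * a * (a + b) ^+ #|U|.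
Proof.
pose c S := a ^+ #|S| * b ^+ #|U :\: S|.
have sum_c u : u \in U ->
    (\sum_(S : {set 'I_n} | (S \subset U) && (u \in S)) c S) * (a + b)
      = a * (a + b) ^+ #|U|.
  (* The factors at [u] and outside [U] are chosen so that the terms with
     [u] not in [S] or [S] not within [U] vanish. *)
  move=> uU; pose f i : K := if i \in U then a else 0.
  pose g i : K := if i \in U then if i == u then 0 else b else 1.
  have <- : \prod_i (f i + g i) = \sum_(S : {set 'I_n} | (S \subset U) && (u \in S)) c S.
    rewrite bigA_distr [RHS]big_mkcond; apply: eq_bigr => S _.
    case: ifP => [/andP[sSU uS]|].
      rewrite /c -!prodr_const [X in X * _]big_mkcond [X in _ * X]big_mkcond -big_split.
      apply: eq_bigr => i _; rewrite in_setD /f /g /=.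
      have [iS|iS] := boolP (i \in S); first by rewrite (subsetP sSU) // mulr1.
      by rewrite mul1r; case: eqP iS uS => // -> /negP.
    move/negbT; rewrite negb_and => /orP[/subsetPn[i iS iU]|uS].
      by rewrite (bigD1 i) //= iS /f (negPf iU) mul0r.
    by rewrite (bigD1 u) //= (negPf uS) /g uU eqxx mul0r.
  have -> : \prod_i (f i + g i) = a * (a + b) ^+ #|U :\ u|.
    rewrite (bigID (mem U)) /= [X in _ * X]big1 ?mulr1 => [|i /negPf iU]; last first.
      by rewrite /f /g iU add0r.
    rewrite (bigD1 u) //= {1}/f {1}/g uU eqxx addr0 -prodr_const; congr (_ * _).
    apply: eq_big => [i|i /andP[iU /negPf iu]]; first by rewrite in_setD1 andbC.
    by rewrite /f /g iU iu.
  by rewrite -mulrA -exprSr [#|U|](cardsD1 u) uU.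
have <- : \sum_(u in U) x u * \sum_(S : {set 'I_n} | (S \subset U) && (u \in S)) c S
    = \sum_(S : {set 'I_n} | S \subset U)
        (\sum_(u in S) x u) * a ^+ #|S| * b ^+ #|U :\: S|.
  under eq_bigr do rewrite big_distrr.
  rewrite (exchange_big_dep (fun S => S \subset U)) /=; last by move=> ? ? _ /andP[].
  apply: eq_bigr => S sSU; rewrite -mulrA big_distrl; apply: eq_bigl => u.
  by rewrite sSU andb_idl //; apply: (subsetP sSU).
rewrite -mulrA !big_distrl; apply: eq_bigr => u uU.
by rewrite /= -mulrA sum_c.
Qed.
End LayerSums.

(** * A weighted Cayley formula *)

Lemma rooted_set0r R : rooted R set0 = [set [ffun=> None]].
Proof.
apply/setP=> F; rewrite in_set1; apply/rootedP/eqP=> [[domF _]|->].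
  by apply/ffunP=> v; rewrite ffunE; apply/eqP; rewrite -[_ == _]negbK domF inE.
by split=> v; rewrite ?ffunE inE.
Qed.

Lemma rooted_set0l U : U != set0 -> rooted set0 U = set0.
Proof.
case/set0Pn=> v vU; apply/setP=> F; rewrite [RHS]inE; apply/negP=> /rootedP[_].
by move=> /(_ v vU) /exists_inP[r]; rewrite inE.
Qed.

Section CayleyFormula.
Variables (K : idomainType) (x : 'I_n -> K).
Hypothesis sum_neq0 : forall U, U != set0 -> \sum_(u in U) x u != 0.

(** The weighted Cayley formula, multiplied by [x(R :|: U)] so that it also holds
    for [U] empty.  In the inductive step the forests on [U] rooted at [S] have
    total weight [x(S) x(U)^(#|U :\: S| - 1)], with exponent [-1] when [S = U]:
    everything is multiplied by [x(U)], which is cancelled at the end. *)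
Lemma sum_rooted_Cayley R U : [disjoint R & U] ->
  (\sum_(F in rooted R U) \prod_(v in U) oapp x 0 (F v)) * (\sum_(u in R :|: U) x u)
    = (\sum_(r in R) x r) * (\sum_(u in R :|: U) x u) ^+ #|U|.
Proof.
have [m] := ubnP #|U|; elim: m R U => // m IHm R U leU dRU.
have [->|U0] := eqVneq U set0.
  by rewrite rooted_set0r setU0 big_set1 big_set0 cards0 mulr1 mul1r.
apply: (mulIf (sum_neq0 U0)).
have sumRU : \sum_(u in R :|: U) x u = \sum_(u in R) x u + \sum_(u in U) x u.
  by rewrite -bigU //=; apply: eq_bigl => u; rewrite !inE.
rewrite mulrAC (sum_layers (fun _ _ => x) dRU) sumRU.
rewrite big_distrl /= [RHS]mulrAC (mulrC (\sum_(r in R) x r)).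
rewrite -sum_subsets_member; congr (_ * _).
apply: eq_bigr => S sSU; rewrite prodr_const.
have [->|S0] := eqVneq S set0.
  by rewrite setD0 rooted_set0l // !big_set0 mulr0 !mul0r.
have SUS : S :|: (U :\: S) = U by rewrite -{1}(setIidPr sSU) setID.
have := IHm S (U :\: S); rewrite SUS => eqT.
rewrite -[LHS]mulrA eqT; first by rewrite mulrCA mulrA.
- rewrite cardsD (setIidPr sSU) -ltnS; apply: leq_trans leU; rewrite ltnS ltn_subrL.
  by rewrite !card_gt0 S0.
- by rewrite disjoint_sym disjoints_subset setDE subsetIr.
Qed.

(** The parent of the marked child of the first layer ranges freely over [R], so
    the layer [S] contributes [y(R) x(R)^(#|S| - 1)] instead of [x(R)^#|S|]. *)
Lemma sum_rooted_marked R U (y : 'I_n -> K) (mark : {set 'I_n} -> option 'I_n) :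
    (forall S, S != set0 -> exists2 v, v \in S & mark S = Some v) ->
    [disjoint R & U] -> R != set0 -> U != set0 ->
  \sum_(F in rooted R U)
      \prod_(v in U) oapp (if mark (layer R F) == Some v then y else x) 0 (F v)
    = (\sum_(r in R) y r) * (\sum_(u in R :|: U) x u) ^+ #|U|.-1.
Proof.
move=> markP dRU R0 U0.
have V0 : R :|: U != set0 by rewrite setU_eq0 negb_and R0.
set T' := LHS; pose T := \sum_(F in rooted R U) \prod_(v in U) oapp x 0 (F v).
suff eqT : T' * (\sum_(r in R) x r) = (\sum_(r in R) y r) * T.
  apply: (mulIf (sum_neq0 R0)); apply: (mulIf (sum_neq0 V0)).
  rewrite eqT -mulrA sum_rooted_Cayley //.
  rewrite -[in LHS](prednK (_ : 0 < #|U|)%N) ?card_gt0 // exprS.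
  by rewrite -!mulrA; congr (_ * _); rewrite [RHS]mulrCA [in RHS]mulrC; ring.
rewrite /T' /T (sum_layers (fun S v => if mark S == Some v then y else x) dRU).
rewrite (sum_layers (fun _ _ => x) dRU) big_distrl big_distrr.
apply: eq_bigr => S sSU /=.
have [->|S0] := eqVneq S set0.
  by rewrite setD0 rooted_set0l // !big_set0 !mulr0 mul0r.
have [v vS markS] := markP S S0.
have -> : \sum_(F in rooted S (U :\: S)) \prod_(v in U :\: S)
     oapp (if mark S == Some v then y else x) 0 (F v)
   = \sum_(F in rooted S (U :\: S)) \prod_(v in U :\: S) oapp x 0 (F v).
  apply: eq_bigr => F _; apply: eq_bigr => u /setDP[_ uS].
  by rewrite markS; case: eqP vS uS => // -[->] ->.
rewrite mulrA mulrAC; congr (_ * _).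
rewrite !(bigD1 v vS) /= markS eqxx -[LHS]mulrA; congr (_ * _).
rewrite mulrC; congr (_ * _); apply: eq_bigr => u /andP[_].
by rewrite (inj_eq Some_inj) eq_sym => /negPf->.
Qed.
End CayleyFormula.

(** * The weight of a forest with a given set of roots *)

Lemma mem_forests k F R :
  (F \in forests n k) && (Vr F == R) = (#|R| == k) && (F \in rooted R (~: R)).
Proof.
apply/idP/idP=> [/andP[]|/andP[/eqP cR /rootedP[domF reachF]]].
  rewrite inE => /andP[acF /eqP nF] /eqP <-; rewrite (card_Vr acF) nF eqxx.
  apply/rootedP; split=> v; first by rewrite !inE.
  by move=> _; move: acF; rewrite acyclicE => /forallP.
have VrF : Vr F = R.
  by apply/setP=> v; rewrite inE -[LHS]negbK domF inE negbK.
have acF : acyclic F.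
  rewrite acyclicE VrF; apply/forallP=> v; have [vR|vR] := boolP (v \in R).
    exact: reach_mem.
  by apply: reachF; rewrite inE.
by rewrite inE acF -card_Vr // VrF cR !eqxx.
Qed.

Definition inversions R : nat :=
  (\sum_(v in R) #|[set v' | v' \notin R & label v' < label v]|)%N.

Definition least S : option 'I_n :=
  [pick v in S | [forall w in S, (label v <= label w)%N]].

Lemma leastP S : S != set0 -> exists2 v, v \in S & least S = Some v.
Proof.
case/set0Pn=> v0 v0S; rewrite /least; case: pickP => [v /andP[vS _]|]; first by exists v.
move/(_ [arg min_(w < v0 in S) label w]); case: arg_minnP => // v vS minv /=.
by rewrite vS => /negP[]; apply/forall_inP.
Qed.

Lemma root_childrenE F : root_children F = layer (Vr F) F.
Proof.
apply/setP=> v; rewrite !inE; apply/exists_inP/idP => [[r rF /eqP->] //|].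
by case Fv: (F v) => [r|] //= rF; exists r.
Qed.

(** Subtracting one from each parent label turns the labels [1..n] into the
    ordinals [0..n-1]. *)
Lemma forest_weightE F :
  forest_weight F
    = (inversions (Vr F) + scindex F + \sum_(v in Vt F) oapp (@nat_of_ord n) 0 (F v))%N.
Proof.
rewrite /forest_weight /niblings -/(inversions _) -addnBA ?card_Vt_le_parents //.
congr addn.
rewrite /parents -sum1_card -sumnB.
  by apply: eq_bigr => v; rewrite /parent_label; case: (F v) => [u|] _ //=; rewrite subn1.
move=> v; rewrite /Vt in_setC in_setU negb_or => /andP[vF _].
by rewrite inE in vF; rewrite /parent_label; case: (F v) vF.
Qed.

Lemma rooted_weight F R : F \in rooted R (~: R) -> ~: R != set0 ->
  ('X^(forest_weight F) : {poly int}) =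
   'X^(inversions R) * \prod_(v in ~: R)
      oapp (if least (layer R F) == Some v then fun r => 'X^(index r (enum R))
            else fun u => 'X^u) 0 (F v).
Proof.
move=> rF U0; have [rootF reachF] := rootedP _ _ _ rF.
have /andP[] : (F \in forests n #|R|) && (Vr F == R) by rewrite mem_forests eqxx.
rewrite inE => /andP[acF _] /eqP VrF.
have L0 : layer R F != set0.
  have /set0Pn[v] := U0; rewrite -VrF -root_childrenE inE; exact: root_children_neq0.
have [v vL fv] := leastP L0.
have vminF : vmin F = Some v by rewrite -fv -VrF -root_childrenE.
move: (vL); rewrite inE; case Fv: (F v) => [r|] //= rR.
have vU : v \in ~: R by rewrite -rootF Fv.
rewrite forest_weightE !exprD VrF -mulrA; congr (_ * _).
rewrite (big_setD1 v vU) /= fv eqxx Fv /= /scindex vminF Fv VrF; congr (_ * _).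
rewrite -prodrXr /Vt /Vs vminF VrF; apply: eq_big => [u|u].
  by rewrite !inE negb_or andbC.
rewrite !inE negb_or => /andP[uR uv].
rewrite (inj_eq Some_inj) eq_sym (negPf uv).
have := rootF u; rewrite inE uR; by case: (F u).
Qed.

(** * Counting inversions over the sets of roots *)

Definition below m : {set 'I_n} := [set i : 'I_n | (i < m)%N].

(** Restricting to the subsets of an initial segment lets the recursion on [m]
    stay inside a single ordinal type: [inversions R] does not depend on [m]. *)
Definition inversion_sum m k : {poly int} :=
  \sum_(R : {set 'I_n} | (R \subset below m) && (#|R| == k)) 'X^(inversions R).

Lemma inversion_sum0 m : inversion_sum m 0 = 1.
Proof.
rewrite /inversion_sum (big_pred1 set0) => [|R]; first by rewrite /inversions big_set0.
by rewrite cards_eq0 /=; case: eqP => [->|]; rewrite ?andbF // sub0set.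
Qed.

Lemma card_below m : (m <= n)%N -> #|below m| = m.
Proof.
move=> le_mn; have inj_w : injective (widen_ord le_mn) by move=> i j [] /val_inj.
rewrite -[RHS]card_ord -(card_imset _ inj_w).
apply: eq_card => i; rewrite inE; apply/idP/imsetP=> [im|[j _ ->] //=].
by exists (Ordinal im) => //; apply/val_inj.
Qed.

Lemma inversion_sum_gt m k : (m <= n)%N -> (m < k)%N -> inversion_sum m k = 0.
Proof.
move=> le_mn lt_mk; rewrite /inversion_sum big_pred0 // => R.
apply/andP=> -[/subset_leq_card]; rewrite card_below // leqNgt => ltR /eqP cR.
by rewrite cR lt_mk in ltR.
Qed.

(** A new largest element [o] forms an inversion with each element below it that
    is not in [R], and leaves the other inversions unchanged. *)
Lemma inversions_add (o : 'I_n) R : R \subset below o ->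
  inversions (o |: R) = (inversions R + (o - #|R|))%N.
Proof.
move=> sR; have Rlt v : v \in R -> (v < o)%N by move=> /(subsetP sR); rewrite inE.
have oR : o \notin R by apply/negP=> /Rlt; rewrite ltnn.
rewrite /inversions big_setU1 //= addnC; congr addn.
  apply: eq_bigr => v /Rlt lt_vo; apply: eq_card => u; rewrite !inE negb_or.
  by case: (eqVneq u o) => //= ->; rewrite /label ltnS (ltnNge o v) (ltnW lt_vo) andbF.
rewrite -{1}(card_below (ltnW (ltn_ord o))).
have -> : #|R| = #|below o :&: R| by rewrite (setIidPr sR).
rewrite -cardsD.
apply: eq_card => u; rewrite !inE negb_or /label ltnS.
by case: (eqVneq u o) => //= ->; rewrite ltnn andbF.
Qed.

(** Pascal's rule, according to whether [R] contains the largest element. *)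
Lemma inversion_sumS m k : (m < n)%N ->
  inversion_sum m.+1 k.+1 = inversion_sum m k.+1 + 'X^(m - k) * inversion_sum m k.
Proof.
move=> lt_mn; pose o := Ordinal lt_mn.
have belowS R : (R \subset below m.+1) && (o \notin R) = (R \subset below m).
  apply/andP/subsetP => [[/subsetP sR oR] v vR|sR].
    have := sR v vR; rewrite !inE ltnS leq_eqVlt => /orP[/eqP vm|//].
    by case/negP: oR; rewrite (_ : o = v) //; apply/val_inj.
  split; last by apply/negP=> /sR; rewrite inE ltnn.
  by apply/subsetP=> v /sR; rewrite !inE => /ltnW.
rewrite {1}/inversion_sum (bigID (fun R : {set 'I_n} => o \notin R)) /=; congr (_ + _).
  by apply: eq_bigl => R; rewrite andbAC belowS.
rewrite (reindex_onto (fun R => o |: R) (fun R => R :\ o)) /=; last first.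
  by move=> R /andP[_]; rewrite negbK; apply: setD1K.
rewrite big_distrr; apply: eq_big => [R|R].
  rewrite -belowS negbK setU11 andbT.
  have [oR|oR] := boolP (o \in R).
    rewrite andbF /=; apply/negP=> /andP[_ /eqP RD].
    by have := oR; rewrite -RD !inE eqxx.
  by rewrite cardsU1 oR add1n eqSS setU1K // eqxx !andbT subUset sub1set inE ltnS leqnn.
move=> /andP[/andP[/andP[sR cR] _] /eqP RD].
have oR : o \notin R by rewrite -RD setD11.
have {}sR : R \subset below m.
  by rewrite -belowS oR (subset_trans _ sR) // subsetU1.
move: cR; rewrite cardsU1 oR eqSS => /eqP cR.
by rewrite (inversions_add (o := o)) //= cR exprD mulrC.
Qed.

Lemma inversion_sumE m k : (m <= n)%N -> (k <= m)%N ->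
  inversion_sum m k * (qfact k * qfact (m - k)) = qfact m.
Proof.
elim: m k => [|m IHm] [|k] // le_mn le_km;
  try by rewrite inversion_sum0 subn0 qfact0 !mul1r.
rewrite inversion_sumS // subSS qfactS; have IHk := IHm k (ltnW le_mn) le_km.
have -> : qfact m.+1 = qfact m * (qnum (m - k) + 'X^(m - k) * qnum k.+1).
  by rewrite qfactS -qnumD addnS subnK.
have E : inversion_sum m k.+1 * (qfact k * qnum k.+1 * qfact (m - k))
    = qfact m * qnum (m - k).
  move: le_km; rewrite ltnS leq_eqVlt => /orP[/eqP ->|lt_km].
    by rewrite inversion_sum_gt ?(ltnW le_mn) // subnn /qnum big_ord0 mulr0 mul0r.
  by rewrite -(IHm k.+1 (ltnW le_mn) lt_km) -(subnSK lt_km) !qfactS; ring.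
by rewrite mulrDl E mulrDr; congr (_ + _); rewrite -IHk; ring.
Qed.

Lemma sum_inversions k : (k <= n)%N ->
  \sum_(R : {set 'I_n} | #|R| == k) 'X^(inversions R) = qbinom n k.
Proof.
move=> le_kn; apply: (mulIf (qfactM_neq0 k (n - k))).
rewrite qbinomE // -(inversion_sumE (leqnn n) le_kn); congr (_ * _); apply: eq_bigl => R.
by rewrite (_ : R \subset below n) //; apply/subsetP=> v _; rewrite inE.
Qed.

(** * Assembling the weights *)

(** At [q = 1] the sum is the cardinal of [U]. *)
Lemma sum_X_neq0 U : U != set0 -> \sum_(u in U) ('X^u : {poly int}) != 0.
Proof.
move=> U0; apply/eqP=> /(congr1 (horner^~ 1)).
rewrite horner_sum horner0 (eq_bigr (fun=> 1)) => [|u _]; last by rewrite hornerXn expr1n.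
by move/eqP; rewrite sumr_const Num.Theory.pnatr_eq0 cards_eq0 (negPf U0).
Qed.

Lemma sum_index R : \sum_(r in R) 'X^(index r (enum R)) = qnum #|R|.
Proof.
rewrite -big_enum /= /qnum cardE.
have := enum_uniq R; move: (enum R) => s us.
case: s us => [|r0 s] us; first by rewrite big_nil big_ord0.
rewrite (big_nth r0) big_mkord; apply: eq_bigr => i _; by rewrite index_uniq.
Qed.

Lemma sum_rooted_weight R : R != set0 -> ~: R != set0 ->
  \sum_(F in rooted R (~: R)) 'X^(forest_weight F)
    = 'X^(inversions R) * (qnum #|R| * qnum n ^+ (n - #|R|).-1).
Proof.
move=> R0 U0.
rewrite (eq_bigr _ (fun F rF => rooted_weight rF U0)).
rewrite -big_distrr /= (sum_rooted_marked sum_X_neq0 _ leastP) //.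
  rewrite sum_index setUCr (cardsCs (~: R)) setCK card_ord.
  by congr (_ * (_ * _ ^+ _)); apply: eq_bigl => u; rewrite inE.
by rewrite disjoints_subset setCK.
Qed.

End RootedMaps.

Theorem corollary3p2 (n k : nat) (hkn : (k <= n)%N) :
  qforests n k = \sum_(F in forests n k) 'X^(forest_weight F).
Proof.
rewrite (partition_big (@Vr n) predT) //=.
transitivity (\sum_(R : {set 'I_n} | #|R| == k)
    \sum_(F in rooted R (~: R)) 'X^(forest_weight F) : {poly int}); last first.
  rewrite [LHS]big_mkcond; apply: eq_bigr => R _; case: ifP => cR.
    by apply: eq_bigl => F; rewrite mem_forests cR.
  by rewrite big_pred0 // => F; rewrite mem_forests cR.
(* For [k = n] there is no smallest child of a root, and the only forest is the
   discrete one. *)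
have [->|ne_kn] := eqVneq k n.
  rewrite (big_pred1 setT) => [|R]; last first.
    have le_Rn : (#|R| <= n)%N by rewrite -[X in (_ <= X)%N]card_ord max_card.
    by rewrite /= eqEcard subsetT cardsT card_ord eqn_leq le_Rn.
  rewrite setCT rooted_set0r big_set1.
  have VrF : Vr [ffun=> None] = setT :> {set 'I_n}.
    by apply/setP=> v; rewrite !inE ffunE.
  have -> : forest_weight ([ffun=> None] : parent_map n) = 0%N.
    rewrite forest_weightE /scindex /Vt VrF setTU setCT big_set0 addn0.
    rewrite /vmin; case: pickP => [v /andP[]|_].
      by rewrite inE ffunE => /exists_inP[].
    rewrite addn0; apply: big1 => v _; apply/eqP; rewrite cards_eq0.
    by apply/eqP/setP=> u; rewrite !inE.
  by rewrite /qforests leqnn subnn qbinomnn mulr1 eqxx if_same.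
have lt_kn : (k < n)%N by rewrite ltn_neqAle ne_kn.
have U0 (R : {set 'I_n}) : #|R| == k -> ~: R != set0.
  move=> /eqP cR; rewrite -card_gt0 cardsCs setCK card_ord cR subn_gt0 //.
have [k0|k_gt0] := posnP k.
  rewrite k0 /qforests /= (big_pred1 set0) => [|R]; last by rewrite /= cards_eq0.
  rewrite rooted_set0l ?big_set0; first by rewrite -k0 eq_sym (negPf ne_kn).
  by apply: U0; rewrite k0 cards0.
transitivity (qbinom n k * (qnum k * qnum n ^+ (n - k).-1)).
  rewrite mulrA qbinom_absorb ?k_gt0 // -mulrA -exprS prednK ?subn_gt0 //.
  by rewrite /qforests gtn_eqF // hkn.
rewrite -sum_inversions // big_distrl; apply: eq_bigr => R cR /=.
rewrite sum_rooted_weight ?U0 ?(eqP cR) //.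
by rewrite -card_gt0 (eqP cR).
Qed.
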